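(* Let $m,n\in\mathbb N$ and let $\pi:\mathbb C^m\to\mathfrak{sl}(n,\mathbb C)$ be a representation of the abelian complex Lie algebra $\mathbb C^m$. Then the realification of the unimodular complex Lie algebra $\mathbb C^m\ltimes_\pi\mathbb C^n$ admits abelian balanced Hermitian structures.
   Context: $\mathbb C^m\ltimes_\pi\mathbb C^n$ is the complex Lie algebra on $\mathbb C^m\oplus\mathbb C^n$ in which $\mathbb C^m$ and $\mathbb C^n$ are abelian and $[x,y]=\pi(x)y$ for $x\in\mathbb C^m$, $y\in\mathbb C^n$. Its realification is the same Lie algebra regarded as a real Lie algebra of dimension $2(m+n)$. A complex structure on a real Lie algebra $\mathfrak g$ is a linear map $J$ with $J^2=-\mathrm{Id}$ and $[JX,JY]-J[JX,Y]-J[X,JY]-[X,Y]=0$; it is abelian if $[JX,JY]=[X,Y]$ for all $X,Y$. A Hermitian structure on $\mathfrak g$, $\dim\mathfrak g=2N$, is a pair $(J,g)$ with $J$ a complex structure and $g$ an inner product with $g(JX,JY)=g(X,Y)$, equivalently denoted $(J,F)$ with $F(X,Y)=g(X,JY)$; it is balanced if $d(F^{N-1})=0$, with $d$ the Chevalley-Eilenberg differential ($d\alpha(X,Y)=-\alpha([X,Y])$ on $1$-forms). $(J,F)$ is an abelian balanced Hermitian structure if $J$ is abelian and $F$ is balanced. *)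

(* Defs.v *)
From HB Require Import structures.
From mathcomp Require Import all_boot all_order all_fingroup all_algebra.
From mathcomp Require Import complex reals.

Set Implicit Arguments.
Unset Strict Implicit.
Unset Printing Implicit Defensive.

Import Order.TTheory GRing.Theory Num.Theory.
Local Open Scope ring_scope.
Local Open Scope complex_scope.

HB.mixin Record Vector_isLieAlgebra (K : fieldType) L of Vector K L := {
  lie : L -> L -> L;
  lie_bilinear : bilinear_for *:%R *:%R lie;
  liexx : forall x, lie x x = 0;
  lie_jacobi : forall x y z,
    lie x (lie y z) + lie y (lie z x) + lie z (lie x y) = 0
}.

#[short(type="lieAlgType")]
HB.structure Definition LieAlgebra (K : fieldType) :=
  {L of Vector_isLieAlgebra K L & Vector K L}.

Section Semidirect.
Variables (K : fieldType) (m n : nat).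
Implicit Type pi : {linear 'cV[K]_m -> 'M[K]_n}.

(* The bracket of K^m vanishes, so that pi is a representation iff all its
   commutators do. *)
Definition is_representation pi :=
  forall x y, pi x *m pi y - pi y *m pi x = 0.

(* K^m |x_pi K^n. The proof of is_representation pi is a parameter because the
   Jacobi identity depends on it. *)
Definition semidirect pi (rep_pi : is_representation pi) : Type :=
  ('cV[K]_m * 'cV[K]_n)%type.

Variables (pi : {linear 'cV[K]_m -> 'M[K]_n}) (rep_pi : is_representation pi).
Local Notation L := (semidirect rep_pi).

HB.instance Definition _ := Vector.copy L ('cV[K]_m * 'cV[K]_n)%type.

Definition semidirect_lie (u v : L) : L :=
  (0, pi u.1 *m v.2 - pi v.1 *m u.2).

Fact semidirect_lie_bilinear : bilinear_for *:%R *:%R semidirect_lie.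
Proof.
split=> -[w1 w2] a [u1 u2] [v1 v2]; congr (_, _);
  rewrite /= ?scaler0 ?addr0 // [pi (_ + _)]linearP mulmxDl mulmxDr;
  by rewrite -scalemxAl -scalemxAr scalerBr opprD addrACA.
Qed.

Fact semidirect_liexx u : semidirect_lie u u = 0.
Proof. by rewrite /semidirect_lie subrr. Qed.

Fact semidirect_lie_jacobi u v w :
  semidirect_lie u (semidirect_lie v w) +
  semidirect_lie v (semidirect_lie w u) +
  semidirect_lie w (semidirect_lie u v) = 0.
Proof.
have C x y (z : 'cV_n) : pi x *m (pi y *m z) = pi y *m (pi x *m z).
  by rewrite !mulmxA; congr (_ *m z); apply/eqP; rewrite -subr_eq0 rep_pi.
congr (_, _) => /=; first by rewrite !addr0.
rewrite linear0 !mul0mx !subr0 !mulmxBr.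
rewrite (C v.1 w.1) (C u.1 v.1) (C u.1 w.1).
by rewrite [X in X + _]addrC !subrKA subrr.
Qed.

HB.instance Definition _ := Vector_isLieAlgebra.Build K L
  semidirect_lie_bilinear semidirect_liexx semidirect_lie_jacobi.

Lemma dim_semidirect : \dim {:L} = (m + n)%N.
Proof. by rewrite dimvf -[m in RHS]muln1 -[n in RHS]muln1. Qed.

End Semidirect.

(* V with scalars restricted from R[i] to R; an alias, so that the two scalings
   do not interfere. *)
Definition realification (R : rcfType) (V : Type) : Type := V.

Section Realification.
Variable R : rcfType.

Section Vect.
Variable V : vectType R[i].
Local Notation VR := (realification R V).

HB.instance Definition _ := GRing.Zmodule.copy VR V.

Definition real_scale (r : R) (v : VR) : VR := r%:C *: (v : V).

Fact real_scaleA a b v :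
  real_scale a (real_scale b v) = real_scale (a * b) v.
Proof. by rewrite /real_scale scalerA rmorphM. Qed.

Fact real_scale1 : left_id 1 real_scale.
Proof. by move=> v; rewrite /real_scale rmorph1 scale1r. Qed.

Fact real_scaleDr : right_distributive real_scale +%R.
Proof. by move=> a u v; rewrite /real_scale scalerDr. Qed.

Fact real_scaleDl v : {morph real_scale^~ v : a b / a + b}.
Proof. by move=> a b; rewrite /real_scale rmorphD scalerDl. Qed.

HB.instance Definition _ := GRing.Zmodule_isLmodule.Build R VR
  real_scaleA real_scale1 real_scaleDr real_scaleDl.

Lemma real_scaleE (r : R) (v : V) : r *: (v : VR) = r%:C *: v :> V.
Proof. by []. Qed.

Import VectorInternalTheory.

Fact realification_vect_iso : Vector.axiom (dim V + dim V) VR.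
Proof.
pose f (v : VR) : 'rV[R]_(dim V + dim V) :=
  row_mx (map_mx (@complex.Re R) (v2r (v : V)))
         (map_mx (@complex.Im R) (v2r (v : V))).
exists f.
  move=> a u v; rewrite /f linearD linearZ /= scale_row_mx add_row_mx.
  congr row_mx; apply/rowP=> i; rewrite !mxE.
    by case: (v2r (u : V) 0 i) (v2r (v : V) 0 i) => [a1 b1] [a2 b2] /=;
      rewrite mul0r subr0.
  by case: (v2r (u : V) 0 i) (v2r (v : V) 0 i) => [a1 b1] [a2 b2] /=;
      rewrite mul0r addr0.
exists (fun r => r2v (\row_i (lsubmx r 0 i +i* rsubmx r 0 i)) : V) => [v|r].
  rewrite /f row_mxKl row_mxKr -[RHS](@v2rK _ V); congr r2v.
  by apply/rowP=> i; rewrite !mxE; case: (v2r _ _ _).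
rewrite /f r2vK -[RHS]hsubmxK.
by congr row_mx; apply/rowP=> i; rewrite !mxE.
Qed.

HB.instance Definition _ := Lmodule_hasFinDim.Build R VR realification_vect_iso.

Lemma dim_realification : \dim {:VR} = (\dim {:V} + \dim {:V})%N.
Proof. by rewrite !dimvf. Qed.

End Vect.

Section Lie.
Variable L : lieAlgType R[i].
Local Notation LR := (realification R L).

Definition real_lie (x y : LR) : LR := lie (x : L) (y : L).

Fact real_lie_bilinear : bilinear_for *:%R *:%R real_lie.
Proof.
have [Bl Br] := @lie_bilinear _ L.
by split=> w a u v; rewrite ?[LHS](Bl w a%:C) ?[LHS](Br w a%:C).
Qed.

HB.instance Definition _ := Vector_isLieAlgebra.Build R LR
  real_lie_bilinear (@liexx _ L) (@lie_jacobi _ L).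

End Lie.
End Realification.

Section Cochains.
Variables (R : rcfType) (L : lieAlgType R).

(* A k-form is a cochain that is multilinear and alternating; the operations
   below are given by formulas that make sense for all cochains. *)
Definition cochain k := {ffun 'I_k -> L} -> R.

(* Normalized so that (a /\ b)(x, y) = a x * b y - a y * b x on 1-forms. *)
Definition wedge p q (a : cochain p) (b : cochain q) : cochain (p + q) :=
  fun v => (p`! * q`!)%:R^-1 *
    \sum_(s : 'S_(p + q)) (-1) ^+ s
      * a [ffun i => v (s (lshift q i))] * b [ffun i => v (s (rshift p i))].

Fixpoint wedge_exp p (a : cochain p) k : cochain (k * p) :=
  if k is k'.+1 then wedge a (@wedge_exp p a k') else fun=> 1.

(* (d a)(v_0, ..., v_k) is the sum over i < j of
     (-1)^(i+j) a([v_i, v_j], v_0, ..., ^v_i, ..., ^v_j, ..., v_k);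
   t |-> bump j (bump i t) enumerates the indices other than i and j. *)
Definition CE_diff k (a : cochain k) : cochain k.+1 :=
  fun v => \sum_(i < k.+1) \sum_(j < k.+1 | (i < j)%N) (-1) ^+ (i + j)
    * a [ffun l : 'I_k => if (l == 0 :> nat) then lie (v i) (v j)
                          else v (inord (bump j (bump i l.-1)))].

End Cochains.

Arguments wedge_exp {R L p} a k v.

Section Hermitian.
Variables (R : rcfType) (L : lieAlgType R).
Implicit Types (J : 'End(L)) (g : {dot L for @idfun R}).

Definition complex_structure J :=
  (forall x, J (J x) = - x) /\
  (forall x y,
     lie (J x) (J y) - J (lie (J x) y) - J (lie x (J y)) - lie x y = 0).

Definition abelian_complex_structure J :=
  complex_structure J /\ forall x y, lie (J x) (J y) = lie x y.

Definition hermitian_structure J g :=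
  complex_structure J /\ forall x y, g (J x) (J y) = g x y.

Definition fundamental_form J g : cochain L 2 :=
  fun v => g (v ord0) (J (v ord_max)).

(* For L = 0 the exponent N - 1 is truncated to 0, and d 1 = 0. *)
Definition balanced J g :=
  let N := (\dim {:L})./2 in
  forall v, CE_diff (wedge_exp (fundamental_form J g) N.-1) v = 0.

Definition abelian_balanced_hermitian J g :=
  [/\ hermitian_structure J g, abelian_complex_structure J & balanced J g].

End Hermitian.

(* Main.v *)
Require Import Defs.
From HB Require Import structures.
From mathcomp Require Import all_boot all_order all_fingroup all_algebra.
From mathcomp Require Import complex reals.
From mathcomp Require Import zify ring.

(** Write L for the realification of C^m |x_pi C^n, and N = m + n. The pair used
    is J (x, y) = (- i x, i y) with the standard inner product of C^N. Since
    pi (- i x) (i y) = pi x y, the structure J is abelian; integrability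
    follows, because [JX, Y] = [JJX, JY] = - [X, JY].

    Let z_p run through the complex coordinates on L together with their
    conjugates. The fundamental form F is a combination of the products
    of a coordinate and its conjugate, because J is diagonal in these
    coordinates. Hence F^(N-1) is a combination of decomposable forms eta, each
    the wedge product of a tuple s of coordinates that is closed under
    conjugation ([wedge_exp_det_form]). If s repeats a coordinate, eta = 0;
    otherwise s omits exactly one coordinate z_b and its conjugate, and the
    claim is that d eta = 0.

    The common kernel W of the coordinates in s is the complex line spanned by
    the basis vector e_b. Expand d eta by the Leibniz rule. The terms without a
    repeated coordinate are of two kinds ([d_det_form_eq0]): those measuring the
    bracket [W, W] modulo W, and, for w in W, a multiple of the trace of ad w
    on L / W. The former vanish since C^m and C^n are abelian. As to the latter,
    if e_b lies in C^m then ad e_b is pi e_b on C^n, of trace 0 by hypothesis,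
    and 0 on C^m; if e_b lies in C^n then ad e_b maps C^m to C^n and C^n
    to 0 ([d_cform_eq0]).

    The computation uses complex valued forms. A decomposable form is the
    determinant of the matrix of values of its factors, so that the Leibniz rule
    becomes a Laplace expansion. *)

Set Implicit Arguments.
Unset Strict Implicit.
Unset Printing Implicit Defensive.

Import Order.TTheory GRing.Theory Num.Theory.
Local Open Scope ring_scope.
Local Open Scope complex_scope.

(** * Determinants and Laplace expansions *)

Section Det.
Variable K : comNzRingType.

Lemma row_mx_ord0 n k (p : 'cV[K]_n) (Z : 'M[K]_(n, k)) i :
  row_mx p Z i ord0 = p i 0.
Proof. by rewrite -(row_mxEl p Z); congr (row_mx _ _ _ _); apply: val_inj. Qed.

Lemma row_mx_lift0 n k (p : 'cV[K]_n) (Z : 'M[K]_(n, k)) i (j : 'I_k) :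
  row_mx p Z i (lift ord0 j) = Z i j.
Proof. by rewrite -(row_mxEr p Z); congr (row_mx _ _ _ _); apply: val_inj. Qed.

Lemma det_row_mx_col n (p : 'cV[K]_n.+1) (Z : 'M[K]_(n.+1, n)) :
  \det (row_mx p Z : 'M_n.+1) =
    \sum_(i < n.+1) (-1) ^+ i * p i 0 * \det (row' i Z).
Proof.
rewrite (expand_det_col _ ord0); apply: eq_bigr => i _.
rewrite row_mx_ord0 /cofactor addn0 mulrCA mulrA; congr (_ * \det _).
by apply/matrixP=> a b; rewrite [LHS]mxE [LHS]mxE row_mx_lift0 mxE.
Qed.

(** Both sides have the same expansion along the column [col r X], up to the
    signs of the position of that column. *)
Lemma det_move_col n (X : 'M[K]_n.+1) r :
  \det (row_mx (col r X) (col' r X) : 'M_n.+1) = (-1) ^+ r * \det X.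
Proof.
rewrite det_row_mx_col (expand_det_col X r) mulr_sumr; apply: eq_bigr => i _.
rewrite mxE /cofactor exprD.
have := sqrr_sign K r; move: ((-1) ^+ r) ((-1) ^+ i) (\det _) (X i r : K).
by move=> e f d x e2; rewrite -[LHS]mul1r -e2; ring.
Qed.

Lemma sum_lift n (V : nmodType) (f : 'I_n.+1 -> V) (i : 'I_n.+1) :
  \sum_(t < n) f (lift i t) = \sum_(j | j != i) f j.
Proof.
rewrite [RHS]big_mkcond (bigD1_ord i) //= eqxx add0r.
by apply: eq_bigr => t _; rewrite eq_sym neq_lift.
Qed.

(** [(i, lift i t)] enumerates the ordered pairs of distinct indices, which are
    grouped by the underlying unordered pair. *)
Lemma sum_lift_pairs n (V : nmodType) (f : 'I_n.+1 -> 'I_n.+1 -> V) :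
  \sum_(i < n.+1) \sum_(t < n) f i (lift i t) =
  \sum_(i < n.+1) \sum_(j < n.+1 | (i < j)%N) (f i j + f j i).
Proof.
under eq_bigr => i _ do
  rewrite sum_lift (bigID (fun j : 'I_n.+1 => i < j)%N) /=.
rewrite big_split /=; under [RHS]eq_bigr do rewrite big_split /=.
rewrite [RHS]big_split /=; congr (_ + _).
  apply: eq_bigr => i _; apply: eq_bigl => j.
  by rewrite neq_ltn; case: (ltngtP i j).
rewrite [RHS](exchange_big_dep predT) //=; apply: eq_bigr => i _.
by apply: eq_bigl => j; rewrite -leqNgt neq_ltn; case: (ltngtP j i).
Qed.

(** Removing position [i], then position [t] of what remains, removes [i] and
    [bump i t]; the right-hand side removes the same two positions, the smaller
    one first. *)
Lemma bump_bump i t l :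
  bump i (bump t l) = if (i < bump i t)%N then bump (bump i t) (bump i l)
                      else bump i (bump (bump i t) l).
Proof.
case: (leqP i t) => it; rewrite [bump i t in RHS]/bump.
  by rewrite it ltnS it bumpC /bump /unbump it ltnNge it subn0.
by rewrite [(i <= t)%N]leqNgt it /= ltnNge ltnW.
Qed.

(** Laplace expansion along the first two columns, with the minors written as
    they occur in [CE_diff]. *)
Lemma det_two_cols n (p q : 'cV[K]_n.+2) (Z : 'M[K]_(n.+2, n)) :
  \det (row_mx p (row_mx q Z) : 'M_n.+2) =
  - \sum_(i < n.+2) \sum_(j < n.+2 | (i < j)%N) (-1) ^+ (i + j) *
      (p i 0 * q j 0 - p j 0 * q i 0) *
      \det (\matrix_(l < n, c < n) Z (inord (bump j (bump i l))) c).
Proof.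
pose D (i j : 'I_n.+2) :=
  \det (\matrix_(l < n, c < n) Z (inord (bump j (bump i l))) c).
(* The term for p in row i and q in row j. If i < j, then row j is at position
   j - 1 once row i is removed, whence the sign. *)
pose f (i j : 'I_n.+2) :=
  if (i < j)%N then (-1) ^+ (i + j).+1 * (p i 0 * q j 0 * D i j)
  else (-1) ^+ (i + j) * (p i 0 * q j 0 * D j i).
transitivity (\sum_(i < n.+2) \sum_(t < n.+1) f i (lift i t)).
  rewrite det_row_mx_col; apply: eq_bigr => i _.
  rewrite (_ : row' i (row_mx q Z) = row_mx (row' i q) (row' i Z)); last first.
    exact: row'_row_mx.
  rewrite det_row_mx_col mulr_sumr; apply: eq_bigr => t _.
  rewrite mxE.
  have minorE : \det (row' t (row' i Z)) =
      if (i < lift i t)%N then D i (lift i t) else D (lift i t) i.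
    have liftE (l : 'I_n) : lift i (lift t l) = inord
       (if (i < lift i t)%N then bump (lift i t) (bump i l)
        else bump i (bump (lift i t) l)) :> 'I_n.+2.
      by rewrite -[LHS]inord_val /= bump_bump.
    rewrite /D; case: ifP => c; congr (\det _); apply/matrixP=> a b;
      by rewrite !mxE liftE c.
  have signE : (if (i < lift i t)%N then (-1) ^+ (i + lift i t).+1
                else (-1) ^+ (i + lift i t)) = (-1) ^+ i * (-1) ^+ t :> K.
    rewrite -exprD /= /bump; case: (leqP i t) => it.
      by rewrite ltnS it addnCA add1n !exprS mulrA mulrNN mulr1 mul1r.
    by rewrite ltnNge ltnW.
  rewrite minorE /f; move: signE; case: ifP => _ ->; ring.
rewrite sum_lift_pairs -sumrN; apply: eq_bigr => i _.
rewrite -sumrN; apply: eq_bigr => j ij.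
rewrite /f ij ltnNge ltnW //= -/(D i j) (addnC j) exprS; ring.
Qed.

Lemma det_col_alternate n (A : 'M[K]_n) (j1 j2 : 'I_n) :
  j1 != j2 -> (forall i, A i j1 = A i j2) -> \det A = 0.
Proof.
move=> j12 Aj; rewrite -det_tr.
by apply: determinant_alternate j12 _ => i; rewrite !mxE.
Qed.

End Det.

(** * The differential of a decomposable form *)

Section DetForm.
Variables (K : comNzRingType) (V : Type) (X : finType) (z : X -> V -> K).

Definition coord_mx n k (s : k.-tuple X) (v : 'I_n -> V) : 'M[K]_(n, k) :=
  \matrix_(i, j) z (tnth s j) (v i).

(** The wedge product of the 1-forms [z x], for [x] in [s]. *)
Definition det_form k (s : k.-tuple X) (v : 'I_k -> V) : K :=
  \det (coord_mx s v).

Lemma det_form_nuniq k (s : k.-tuple X) v : ~~ uniq s -> det_form s v = 0.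
Proof.
rewrite -[X in uniq X]map_tnth_enum => /injectivePn[i [j ij sij]].
by apply: det_col_alternate ij _ => l; rewrite !mxE sij.
Qed.

Variables (b : V -> V -> V) (c : X -> X -> X -> K).
Hypothesis zb : forall r x y,
  z r (b x y) = \sum_p \sum_q c r p q * (z p x * z q y - z p y * z q x).

(** The Chevalley-Eilenberg differential of [det_form s] for the bracket [b], by
    the formula of [CE_diff]. *)
Definition d_det_form k (s : k.-tuple X) (v : 'I_k.+1 -> V) : K :=
  \sum_(i < k.+1) \sum_(j < k.+1 | (i < j)%N) (-1) ^+ (i + j) *
    det_form s (fun l : 'I_k => if (l == 0 :> nat) then b (v i) (v j)
                                else v (inord (bump j (bump i l.-1)))).

(** The wedge product of [z p], [z q] and the factors of [det_form s] other than
    the [r]-th. *)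
Definition det_subst k (s : k.+1.-tuple X) (v : 'I_k.+2 -> V) r p q : K :=
  \det (row_mx (\col_i z p (v i)) (row_mx (\col_i z q (v i))
    (col' r (coord_mx s v))) : 'M_k.+2).

Lemma det_substE k (s : k.+1.-tuple X) v r p q :
  det_subst s v r p q = - \sum_(i < k.+2) \sum_(j < k.+2 | (i < j)%N)
    (-1) ^+ (i + j) * (z p (v i) * z q (v j) - z p (v j) * z q (v i)) *
    \det (\matrix_(l < k, t < k)
      col' r (coord_mx s v) (inord (bump j (bump i l))) t).
Proof.
rewrite /det_subst det_two_cols; congr (- _).
by apply: eq_bigr => i _; apply: eq_bigr => j _; rewrite !mxE.
Qed.

Lemma det_substC k (s : k.+1.-tuple X) v r p q :
  det_subst s v r p q = - det_subst s v r q p.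
Proof.
rewrite !det_substE opprK -sumrN; apply: eq_bigr => i _.
by rewrite -sumrN; apply: eq_bigr => j _; ring.
Qed.

Lemma det_substxx k (s : k.+1.-tuple X) v r p : det_subst s v r p p = 0.
Proof.
rewrite det_substE big1 ?oppr0 // => i _.
by rewrite big1 // => j _; ring.
Qed.

Lemma det_subst_mem k (s : k.+1.-tuple X) v r p q :
  p \in s -> p != tnth s r -> det_subst s v r p q = 0.
Proof.
case/tnthP=> i ->; case: (unliftP r i) => [j ->|-> /eqP//] _.
apply: (@det_col_alternate _ _ _ ord0 (lift ord0 (lift ord0 j))) => // l.
by rewrite row_mx_ord0 !row_mx_lift0 !mxE.
Qed.

Lemma det_subst_tnth k (s : k.+1.-tuple X) v r q :
  det_subst s v r (tnth s r) q =
  (-1) ^+ r.+1 * \det (row_mx (\col_i z q (v i)) (coord_mx s v) : 'M_k.+2).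
Proof.
pose M : 'M[K]_k.+2 := row_mx (\col_i z q (v i)) (coord_mx s v).
rewrite -/M -(det_move_col M (lift ord0 r)); congr (\det _).
apply/matrixP=> i j; case: (unliftP ord0 j) => [{}j|] ->; last first.
  by rewrite !row_mx_ord0 [LHS]mxE [RHS]mxE row_mx_lift0 mxE.
rewrite !row_mx_lift0 [RHS]mxE; case: (unliftP ord0 j) => [{}j|] ->; last first.
  rewrite row_mx_ord0 (_ : lift (lift ord0 r) (ord0 : 'I_k.+1) = ord0).
    by rewrite row_mx_ord0 !mxE.
  exact: val_inj.
rewrite row_mx_lift0.
have -> : lift (lift ord0 r) (lift ord0 (j : 'I_k) : 'I_k.+1) =
  lift ord0 (lift r j) by apply: val_inj; rewrite /= bumpS.
by rewrite row_mx_lift0 !mxE.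
Qed.

(** The Leibniz rule: [z r] has differential the sum of the
    [- c r p q z p /\ z q]. It amounts to expanding each determinant in
    [d_det_form] along the row of the bracket, then collecting the pairs of
    arguments by [det_two_cols]. *)
Lemma d_det_formE k (s : k.+1.-tuple X) v :
  d_det_form s v = - \sum_(r < k.+1) (-1) ^+ r *
    \sum_p \sum_q c (tnth s r) p q * det_subst s v r p q.
Proof.
rewrite -sumrN.
under [RHS]eq_bigr => r _.
  rewrite mulr_sumr -sumrN.
  under eq_bigr => p _.
    rewrite mulr_sumr -sumrN.
    under eq_bigr => q _.
      rewrite det_substE mulrN mulrN opprK !mulr_sumr.
      over.
    rewrite exchange_big /=.
    over.
  rewrite exchange_big /=.
  over.
rewrite exchange_big /=; apply: eq_bigr => i _.
under [RHS]eq_bigr => r _.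
  under eq_bigr => p _.
    under eq_bigr => q _ do rewrite !mulr_sumr.
    rewrite exchange_big /=.
    over.
  rewrite exchange_big /=.
  over.
rewrite exchange_big /=; apply: eq_bigr => j ij.
rewrite /det_form (expand_det_row _ ord0) mulr_sumr; apply: eq_bigr => r _.
rewrite mxE /= zb !mulr_suml mulr_sumr; apply: eq_bigr => p _.
rewrite !mulr_suml mulr_sumr; apply: eq_bigr => q _.
rewrite /cofactor add0n; set D := \det _; set D' := \det _.
have -> : D = D'; last by ring.
by congr (\det _); apply/matrixP=> a t; rewrite !mxE.
Qed.

Lemma d_det_form_nuniq k (s : k.-tuple X) v : ~~ uniq s -> d_det_form s v = 0.
Proof.
move=> us; apply: big1 => i _; apply: big1 => j _.
by rewrite det_form_nuniq ?mulr0.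
Qed.

(** Let W be the common kernel of the [z r], [r] in [s]. If the [z p] are the
    coordinates for some basis, the first hypothesis makes W a subalgebra, and
    the second one says that [ad w] has trace 0 on the quotient by W for [w] in
    W. In the Leibniz rule, replacing [z r] by [z p /\ z q] gives 0 if [p] or
    [q] is in [s] and is not [r], or if [p] and [q] are both [r]. So either [p]
    and [q] are not in [s], where the first hypothesis applies, or one of them
    is [r] and the other one, say [p], is not in [s]; then the product is
    [z p /\ det_form s] up to sign, and the coefficients of that form add up to
    a trace. *)
Lemma d_det_form_eq0 k (s : k.-tuple X) v :
    (forall r p q, r \in s -> p \notin s -> q \notin s -> c r p q = 0) ->
    (forall p, p \notin s -> \sum_(r <- s) (c r p r - c r r p) = 0) ->
  d_det_form s v = 0.
Proof.
case: k s v => [|k] s v c0 tr0.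
  by rewrite /d_det_form big_ord1 big_pred0 // => j; rewrite [j]ord1 ltnn.
rewrite d_det_formE.
pose E p := \det (row_mx (\col_i z p (v i)) (coord_mx s v) : 'M_k.+2).
have subE r : \sum_p \sum_q c (tnth s r) p q * det_subst s v r p q =
    \sum_(p | p \notin s)
      (c (tnth s r) (tnth s r) p - c (tnth s r) p (tnth s r)) *
      ((-1) ^+ r.+1 * E p).
  set t := tnth s r; have ts : t \in s by exact: mem_tnth.
  rewrite (bigID (mem s)) /= (bigD1 t) //=.
  rewrite [X in _ + X + _]big1 ?addr0; last first.
    by move=> p /andP[ps pt]; apply: big1 => q _; rewrite det_subst_mem ?mulr0.
  rewrite (bigID (mem s)) /= big1 ?add0r => [|q qs]; last first.
    have [->|qt] := eqVneq q t; first by rewrite det_substxx mulr0.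
    by rewrite det_substC det_subst_mem // oppr0 mulr0.
  rewrite -big_split; apply: eq_bigr => p ps /=.
  rewrite (bigID (mem s)) /=.
  rewrite [X in _ + (_ + X)]big1 ?addr0 => [|q qs]; last first.
    by rewrite c0 ?mul0r.
  rewrite (bigD1 t) //=.
  rewrite [X in _ + (_ + X)]big1 ?addr0 => [|q /andP[qs qt]]; last first.
    by rewrite det_substC det_subst_mem // oppr0 mulr0.
  by rewrite (det_substC _ _ _ p) det_subst_tnth -/(E p); ring.
under eq_bigr do rewrite subE mulr_sumr.
rewrite exchange_big big1 ?oppr0 // => p ps /=.
transitivity (E p * \sum_(r <- s) (c r p r - c r r p)); last first.
  by rewrite tr0 ?mulr0.
rewrite big_tuple mulr_sumr; apply: eq_bigr => r _.
rewrite exprS mulN1r; move: (sqrr_sign K r); set e := (-1) ^+ r => e2.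
by rewrite -[RHS]mul1r -e2; ring.
Qed.

End DetForm.

(** * Powers of a 2-form *)

Section WedgeDet.
Variables (K : comNzRingType) (V : Type) (X : finType) (z : X -> V -> K).

Lemma eq_det_form k (s : k.-tuple X) (v w : 'I_k -> V) :
  v =1 w -> det_form z s v = det_form z s w.
Proof. by move=> vw; congr (\det _); apply/matrixP=> i j; rewrite !mxE vw. Qed.

Lemma det_form_perm k (s : k.-tuple X) (v : 'I_k -> V) :
  det_form z s v = \sum_(u : 'S_k) (-1) ^+ u * \prod_i z (tnth s i) (v (u i)).
Proof.
rewrite /det_form -det_tr; apply: eq_bigr => u _; congr (_ * _).
by apply: eq_bigr => i _; rewrite !mxE.
Qed.

(** The antisymmetrization that defines the wedge product of [z p], [z q] and
    [det_form z s]. Expand the latter over permutations [t] of its arguments;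
    for fixed [t], the substitution of [e t * u] for [u], where [e t] extends
    [t] by fixing the first two positions, turns the sum over [u] into the
    determinant on the right. *)
Lemma sum_perm_det_form k (s : k.-tuple X) p q (v : 'I_k.+2 -> V) :
  \sum_(u : 'S_k.+2) (-1) ^+ u * z p (v (u ord0)) * z q (v (u (lift ord0 ord0)))
     * det_form z s (fun i => v (u (lift ord0 (lift ord0 i)))) =
  k`!%:R * det_form z [tuple of p :: q :: s] v.
Proof.
have tpq0 : tnth [tuple of p :: q :: s] ord0 = p by [].
have tpq1 : tnth [tuple of p :: q :: s] (lift ord0 ord0) = q by [].
have tpq2 i : tnth [tuple of p :: q :: s] (lift ord0 (lift ord0 i)) = tnth s i.
  by rewrite !(tnth_nth p).
pose e (t : 'S_k) : 'S_k.+2 := lift_perm ord0 ord0 (lift_perm ord0 ord0 t).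
under eq_bigr => u _.
  rewrite det_form_perm mulr_sumr.
  over.
rewrite exchange_big /= -card_Sn -sum1_card natr_sum mulr_suml.
apply: eq_bigr => t _; rewrite mul1r det_form_perm.
rewrite [RHS](reindex_inj (mulgI (e t))); apply: eq_bigr => u _.
rewrite odd_permM !odd_lift_perm /= signr_addb !big_ord_recl tpq0 tpq1 !permM.
rewrite !lift_perm_lift !lift_perm_id.
under [in RHS]eq_bigr => i _ do rewrite tpq2 permM !lift_perm_lift.
move: ((-1) ^+ u) ((-1) ^+ t) (z p _) (z q _) (\prod_(i < k) _) => e1 e2 a b d.
ring.
Qed.

End WedgeDet.

Section WedgeExp.
Variables (R : rcfType) (L : lieAlgType R) (X : finType).
Variables (z : X -> L -> R[i]) (cj : X -> X) (kap : X -> R[i]).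
Variable F : cochain L 2.
Hypothesis cjK : involutive cj.
Hypothesis FE : forall v, (F v)%:C =
  \sum_p kap p * (z p (v ord0) * z (cj p) (v ord_max)).

(** By induction, since each term of the expansion of [F] adds to a tuple a
    coordinate and its image under [cj]. *)
Lemma wedge_exp_det_form k :
  exists (I : finType) (a : I -> R[i]) (s : I -> (k * 2).-tuple X),
    (forall i x, x \in s i -> cj x \in s i) /\
    forall v, (wedge_exp F k v)%:C = \sum_i a i * det_form z (s i) v.
Proof.
elim: k => [|k [I [a [s [sc wE]]]]].
  exists unit, (fun=> 1), (fun=> [tuple]); split=> // v.
  by rewrite (big_pred1 tt) => [|[]] //; rewrite /det_form det_mx00 mulr1.
pose q := (k * 2)%N.
exists (X * I)%type.
exists (fun xi => ((2`! * q`!)%:R^-1)%:C * q`!%:R * kap xi.1 * a xi.2).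
exists (fun xi => [tuple of xi.1 :: cj xi.1 :: s xi.2]); split.
  move=> [x i] y /=; rewrite !inE => /or3P[/eqP->|/eqP->|/sc->].
  - by rewrite eqxx orbT.
  - by rewrite cjK eqxx.
  - by rewrite !orbT.
move=> v; rewrite /= /wedge -/q rmorphM /=.
rewrite -(pair_bigA _ (fun x i => ((2`! * q`!)%:R^-1)%:C * q`!%:R * kap x *
  a i * det_form z [tuple of x :: cj x :: s i] v)) /=.
rewrite rmorph_sum mulr_sumr.
transitivity (\sum_(u : 'S_(2 + q)) \sum_x \sum_i
    ((2`! * q`!)%:R^-1)%:C * kap x * a i * ((-1) ^+ u *
      z x (v (u ord0)) * z (cj x) (v (u (lift ord0 ord0))) *
      det_form z (s i) (fun l => v (u (lift ord0 (lift ord0 l)))))).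
  apply: eq_bigr => u _.
  rewrite !rmorphM /= rmorph_sign FE wE -!mulrA big_distrlr /= !mulr_sumr.
  apply: eq_bigr => x _; rewrite !mulr_sumr; apply: eq_bigr => i _.
  rewrite !ffunE.
  have -> : lshift q (ord0 : 'I_2) = (ord0 : 'I_q.+2) by exact: val_inj.
  have -> : lshift q (ord_max : 'I_2) = (lift ord0 ord0 : 'I_q.+2).
    exact: val_inj.
  rewrite (@eq_det_form _ _ _ _ _ _ _
    (fun l => v (u (lift ord0 (lift ord0 l))))).
    move: (_%:C) (_ ^+ u) (kap x) (a i) (z x _) (z (cj x) _) (det_form z _ _).
    by move=> *; ring.
  by move=> l; rewrite ffunE; congr (v (u _)); apply: val_inj.
rewrite exchange_big /=; apply: eq_bigr => x _.
rewrite exchange_big /=; apply: eq_bigr => i _.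
rewrite -mulr_sumr sum_perm_det_form.
by move: (_%:C) (q`!%:R : R[i]) (kap x) (a i) (det_form z _ _) => *; ring.
Qed.

End WedgeExp.

(** * The abelian Hermitian structure on the semidirect product *)

Lemma sum_supp_codom (I J : finType) (M : nmodType) (h : I -> J) (g : J -> M) :
    injective h -> (forall p, p \notin codom h -> g p = 0) ->
  \sum_p g p = \sum_i g (h i).
Proof.
move=> hI g0; rewrite (bigID (mem (codom h))) /= [X in _ + X]big1 // addr0.
rewrite -big_uniq /=; first by rewrite big_image.
by rewrite map_inj_uniq ?enum_uniq.
Qed.

Section SemidirectProduct.
Variables (R : rcfType) (m n : nat).
Variables (pi : {linear 'cV[R[i]]_m -> 'M[R[i]]_n}).
Variable rep_pi : is_representation pi.
Local Notation L := (semidirect rep_pi).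
Local Notation LR := (realification R L).
Local Notation C := R[i].
Local Notation W := ('I_m + 'I_n)%type.
Local Notation X := (W * bool)%type.

Definition coord (w : W) (x : LR) : C :=
  match w with inl a => x.1 a 0 | inr a => x.2 a 0 end.

Definition twist (x : LR) : LR := (- 'i%C *: x.1, 'i%C *: x.2).

Fact twist_linear : linear twist.
Proof.
by move=> r x y; congr (_, _) => /=; rewrite scalerDr !scalerA mulrC.
Qed.

HB.instance Definition _ :=
  GRing.isLinear.Build R LR LR *:%R twist twist_linear.

Lemma twistK x : twist (twist x) = - x.
Proof.
case: x => a b; congr (_, _) => /=;
  by rewrite scalerA ?mulrNN -expr2 sqr_i scaleN1r.
Qed.

Lemma lie_twist x y : lie (twist x) (twist y) = lie x y.
Proof.
congr (_, _); rewrite /= !linearZ /= -!scalemxAl scalerN !scalerA.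
by rewrite mulrN -expr2 sqr_i opprK !scale1r.
Qed.

Lemma lie_twistr x y : lie x (twist y) = - lie (twist x) y.
Proof.
congr (_, _); rewrite /= ?oppr0 // !linearZ /= -!scalemxAl.
move: (pi x.1 *m y.2) (pi y.1 *m x.2) => A B.
by rewrite !scalerN !scaleNr opprD !opprK.
Qed.

Definition twist_eigen (w : W) : C := if w is inl _ then - 'i%C else 'i%C.

Lemma conjc_twist_eigen w : conjc (twist_eigen w) = - twist_eigen w.
Proof.
by case: w => a; apply/eqP; rewrite eq_complex /= ?oppr0 ?opprK !eqxx.
Qed.

Lemma coord_twist w x : coord w (twist x) = twist_eigen w * coord w x.
Proof. by case: w => a /=; rewrite mxE. Qed.

Lemma coordP r w x y : coord w (r *: x + y) = r%:C * coord w x + coord w y.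
Proof. by case: w => a /=; rewrite !mxE. Qed.

Definition std_dot (x y : LR) : R :=
  \sum_w complex.Re (conjc (coord w x) * coord w y).

Lemma std_dotC x y : std_dot x y = std_dot y x.
Proof.
by apply: eq_bigr => w _; case: (coord w x) (coord w y) => [a b] [c d] /=; ring.
Qed.

Lemma std_dotP z r x y : std_dot z (r *: x + y) = r * std_dot z x + std_dot z y.
Proof.
rewrite /std_dot mulr_sumr -big_split; apply: eq_bigr => w _ /=; rewrite coordP.
by case: (coord w x) (coord w y) (coord w z) => [a b] [c d] [e f] /=; ring.
Qed.

Fact std_dot_bilinear : bilinear_for *%R (@idfun R \; *%R) std_dot.
Proof.
split=> z r x y /=; last exact: std_dotP.
by rewrite ![std_dot _ z]std_dotC std_dotP.
Qed.

HB.instance Definition _ :=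
  bilinear_isBilinear.Build R LR LR R _ _ std_dot std_dot_bilinear.

Fact std_dot_hermitian x y : std_dot x y = (-1) ^+ false * idfun (std_dot y x).
Proof. by rewrite mul1r std_dotC. Qed.

HB.instance Definition _ :=
  isHermitianSesquilinear.Build R LR false idfun std_dot std_dot_hermitian.

Fact std_dot_gt0 x : x != 0 -> 0 < std_dot x x.
Proof.
have sq0 w : 0 <= complex.Re (conjc (coord w x) * coord w x).
  case: (coord w x) => a b /=.
  by rewrite mulNr opprK addr_ge0 // -expr2 sqr_ge0.
rewrite lt_def sumr_ge0 // andbT; apply: contraNneq => /eqP.
rewrite psumr_eq0 // => /allP x0.
have {}x0 w : coord w x = 0.
  have := x0 w (mem_index_enum _); case: (coord w x) => a b /=.
  rewrite mulNr opprK paddr_eq0 -?expr2 ?sqr_ge0 // !sqrf_eq0.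
  by case/andP=> /eqP-> /eqP->.
apply/eqP; case: x x0 {sq0} => a b x0.
congr (_, _); apply/colP=> i; rewrite mxE.
  exact: (x0 (inl i)).
exact: (x0 (inr i)).
Qed.

HB.instance Definition _ := isDotProduct.Build R LR std_dot std_dot_gt0.

Lemma std_dot_twist x y : std_dot (twist x) (twist y) = std_dot x y.
Proof.
apply: eq_bigr => w _; rewrite !coord_twist.
by case: (coord w x) (coord w y) => [a b] [c d]; case: w => w /=; ring.
Qed.

Definition std_J : 'End(LR) := linfun twist.

Lemma std_JE x : std_J x = twist x. Proof. exact: lfunE. Qed.

Lemma abelian_std_J : abelian_complex_structure std_J.
Proof.
have lieJ x y : lie (std_J x) (std_J y) = lie x y.
  by rewrite (std_JE x) (std_JE y); exact: lie_twist.
have lieJr x y : lie x (std_J y) = - lie (std_J x) y.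
  by rewrite (std_JE x) (std_JE y); exact: lie_twistr.
have JK x : std_J (std_J x) = - x.
  by rewrite (std_JE x) (std_JE (twist x)); exact: twistK.
split; [split; [exact: JK | move=> x y] | exact: lieJ].
by rewrite lieJ lieJr [std_J (- _)]linearN opprK subrK subrr.
Qed.

Lemma std_dot_std_J x y : std_dot (std_J x) (std_J y) = std_dot x y.
Proof. by rewrite (std_JE x) (std_JE y) std_dot_twist. Qed.

Definition cform (p : X) (x : LR) : C :=
  if p.2 then conjc (coord p.1 x) else coord p.1 x.

Definition cj (p : X) : X := (p.1, ~~ p.2).

Lemma cjK : involutive cj. Proof. by case=> w e; rewrite /cj /= negbK. Qed.

Definition fundamental_coef (p : X) : C :=
  2^-1 * (twist_eigen p.1 * (-1) ^+ (~~ p.2)).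

Definition std_metric : {dot LR for @idfun R} := std_dot.

(** [std_J] multiplies the coordinate [w] by [twist_eigen w], which is
    imaginary; hence the real part in [std_dot x (std_J y)] is half the
    difference of two products of a coordinate and a conjugate coordinate. *)
Lemma fundamental_formE v : (fundamental_form std_J std_metric v)%:C =
  \sum_p fundamental_coef p * (cform p (v ord0) * cform (cj p) (v ord_max)).
Proof.
rewrite /fundamental_form /std_metric std_JE /= /std_dot rmorph_sum /=.
rewrite -(pair_bigA _ (fun w e => fundamental_coef (w, e) *
  (cform (w, e) (v ord0) * cform (cj (w, e)) (v ord_max)))) /=.
apply: eq_bigr => w _; rewrite big_bool /fundamental_coef /cform /= coord_twist.
have cM (a b : C) : conjc (a * b) = conjc a * conjc b by exact: rmorphM.
rewrite ReJ_add !cM conjcK conjc_twist_eigen.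
move: (coord w (v ord0)) (coord w (v ord_max)) => a b.
move: (conjc a) (conjc b) => a' b'.
move: (2^-1 : C) (twist_eigen w) => h e; rewrite expr0 expr1; ring.
Qed.

(** Half of the structure constants, in the sense of [cform_lie]: the pairs
    [(p, q)] in which [p] is a coordinate on C^n do not contribute. *)
Definition struct_const (r p q : X) : C :=
  if (p.2 == r.2) && (q.2 == r.2) then
    match r.1, p.1, q.1 with
    | inr a, inl b, inr d =>
       let e := pi (delta_mx b 0) a d in if r.2 then conjc e else e
    | _, _, _ => 0
    end else 0.

Lemma cform_lie r x y : cform r (lie x y : LR) =
  \sum_p \sum_q struct_const r p q *
    (cform p x * cform q y - cform p y * cform q x).
Proof.
have lieE a : coord (inr a) (lie x y) = \sum_b \sum_d pi (delta_mx b 0) a d *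
    (coord (inl b) x * coord (inr d) y - coord (inl b) y * coord (inr d) x).
  have piE (u : 'cV_m) (w : 'cV_n) : (pi u *m w) a 0 =
      \sum_b \sum_d pi (delta_mx b 0) a d * (u b 0 * w d 0).
    rewrite {1}(matrix_sum_delta u) linear_sum /= mulmx_suml summxE.
    apply: eq_bigr => b _.
    rewrite big_ord1 linearZ /= -scalemxAl !mxE mulr_sumr.
    by apply: eq_bigr => d _; ring.
  rewrite /= [LHS]mxE [X in _ + X]mxE !piE -sumrB; apply: eq_bigr => b _.
  by rewrite -sumrB; apply: eq_bigr => d _; rewrite mulrBr.
have sumE a e (f : X -> X -> C) :
    \sum_p \sum_q struct_const (inr a, e) p q * f p q =
    \sum_b \sum_d struct_const (inr a, e) (inl b, e) (inr d, e) *
      f (inl b, e) (inr d, e).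
  pose hl b : X := (inl b, e); pose hr d : X := (inr d, e).
  rewrite (sum_supp_codom (h := hl)) => [|b b' []//|[w e'] pe]; last first.
    rewrite big1 // => q _; rewrite /struct_const /=.
    case: ifP => [/andP[/eqP e'e _]|]; last by rewrite mul0r.
    case: w pe => [b|d] pe; last by rewrite mul0r.
    by case/negP: pe; rewrite e'e; apply/codomP; exists b.
  apply: eq_bigr => b _.
  apply: (sum_supp_codom (h := hr)) => [d d' []//|[w e'] pe].
  rewrite /struct_const /=.
  case: ifP => [/andP[_ /eqP e'e]|]; last by rewrite mul0r.
  case: w pe => [d|d] pe; first by rewrite mul0r.
  by case/negP: pe; rewrite e'e; apply/codomP; exists d.
case: r => [[a|a] e]; last first.
  rewrite sumE /cform lieE /=; case: e; last first.
    by apply: eq_bigr => b _; apply: eq_bigr => d _.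
  rewrite rmorph_sum; apply: eq_bigr => b _.
  rewrite rmorph_sum; apply: eq_bigr => d _.
  by rewrite rmorphM rmorphB !rmorphM.
rewrite big1 => [|p _]; last first.
  by rewrite big1 // => q _; rewrite /struct_const /=; case: ifP; rewrite mul0r.
by rewrite /cform /= mxE; case: e; rewrite ?rmorph0.
Qed.

Lemma card_coord_index : #|{: X}| = ((m + n) * 2)%N.
Proof. by rewrite card_prod card_sum !card_ord card_bool. Qed.

(** A duplicate-free tuple of [2 (N - 1)] coordinates that is closed under
    conjugation misses only a coordinate and its conjugate. *)
Lemma d_cform_eq0 k (s : (k * 2).-tuple X) v :
    (forall x, \tr (pi x) = 0) -> k = (m + n).-1 ->
    (forall p, p \in s -> cj p \in s) ->
  d_det_form cform (@lie _ LR) s v = 0.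
Proof.
move=> tr0 kE sc.
have [us|] := boolP (uniq s); last exact: d_det_form_nuniq.
have compl p q : p \notin s -> q \notin s -> p.1 = q.1.
  move=> ps qs.
  have cs p' : p' \notin s -> cj p' \notin s.
    by apply: contra => /sc; rewrite cjK.
  have : (#|[predC s]| <= 2)%N.
    have : (k * 2 + #|[predC s]| = (m + n) * 2)%N.
      by rewrite -card_coord_index -(cardC [in s]) (card_uniqP us) size_tuple.
    lia.
  apply: contraTeq => pq; rewrite -ltnNge.
  have /card_uniqP pq3 : uniq [:: p; cj p; q].
    case: p q pq {ps qs} => [w e] [w' e'] /= ww'.
    by rewrite /= !inE !xpair_eqE (negPf ww') eqxx; case: (e).
  rewrite -[3%N]/(size [:: p; cj p; q]) -pq3.
  apply/subset_leq_card/subsetP => r; rewrite !inE.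
  by case/or3P => /eqP ->; rewrite ?cs.
apply: (@d_det_form_eq0 _ _ _ cform (@lie _ LR) struct_const cform_lie)
  => [r p q _ ps qs|p ps].
  rewrite /struct_const; case: ifP => // _.
  by move: (compl _ _ ps qs); case: r.1 p.1 q.1 => [?|a] [b|?] [?|d].
have {}compl q : q \notin s -> q.1 = p.1 by move/(compl _ _ ps).
rewrite big_uniq //= big_mkcond /=.
(* The sum may run over all r: for r not in s, the coordinates p and r are both
   on C^m or both on C^n. *)
pose f r := struct_const r p r.
transitivity (\sum_r f r).
  apply: eq_bigr => r _.
  have -> : struct_const r r p = 0.
    by rewrite /struct_const; case: ifP => // _; case: r.1.
  rewrite subr0; case: ifPn => // /compl rp.
  by rewrite /f /struct_const rp; case: ifP => // _; case: p.1.
rewrite /f /struct_const; case: p {ps compl f} => [[b|b] e] /=.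
  pose A := pi (delta_mx b 0); pose h a : X := (inr a, e).
  transitivity (\sum_a if e then conjc (A a a) else A a a).
    rewrite (sum_supp_codom (h := h)) => [|a a' []//|[w e'] pe].
      by apply: eq_bigr => a _; rewrite !eqxx.
    case: w pe => [a|a] pe; first by rewrite if_same.
    case: eqP => //= e'e; case/negP: pe; rewrite -e'e.
    by apply/codomP; exists a.
  clear h; case: e; last exact: tr0.
  by rewrite -rmorph_sum -/(mxtrace A) tr0 rmorph0.
by rewrite big1 // => r _; case: ifP => // _; case: r.1.
Qed.

End SemidirectProduct.

Theorem proposition5p4 (R : realType) (m n : nat)
    (pi : {linear 'cV[R[i]]_m -> 'M[R[i]]_n})
    (rep_pi : is_representation pi) (sl_pi : forall x, \tr (pi x) = 0) :
  exists (J : 'End(realification R (semidirect rep_pi)))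
         (g : {dot realification R (semidirect rep_pi) for @idfun R}),
    abelian_balanced_hermitian J g.
Proof.
exists (std_J rep_pi), (std_metric rep_pi).
have Jabelian := abelian_std_J rep_pi.
split; [split; [exact: Jabelian.1 | exact: std_dot_std_J] | exact: Jabelian |].
rewrite /balanced dim_realification dim_semidirect addnn doubleK => v.
set k := (m + n).-1; set F := fundamental_form _ _.
have [I [a [s [sc wE]]]] :=
  wedge_exp_det_form (@cjK m n) (@fundamental_formE R m n pi rep_pi) k.
suff /complexI : (CE_diff (wedge_exp F k) v)%:C = 0 by [].
transitivity
  (\sum_i a i * d_det_form (@cform R m n pi rep_pi) (@lie _ _) (s i) v).
  rewrite /CE_diff rmorph_sum /=.
  under eq_bigr => i _.
    rewrite rmorph_sum /=.
    under eq_bigr => j _.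
      rewrite rmorphM /= rmorph_sign wE mulr_sumr.
      over.
    rewrite exchange_big /=.
    over.
  rewrite exchange_big /=; apply: eq_bigr => t _.
  rewrite /d_det_form mulr_sumr; apply: eq_bigr => i _.
  rewrite mulr_sumr; apply: eq_bigr => j _.
  rewrite mulrCA; congr (_ * (_ * _)).
  by apply: eq_det_form => l; rewrite ffunE.
by apply: big1 => i _; rewrite d_cform_eq0 ?mulr0 // => p; apply: sc.
Qed.
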